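(* Let $\mathcal{M}_r\subseteq\mathbb{R}^{l_1^r\times\dots\times l_D^r}$, $r=1,\dots,R$, be Tucker core structures. Assume that the tensor $\mathcal{A}\in\mathbb{R}^{n_1\times\dots\times n_D}$ has an orthogonal Tucker decomposition $\mathcal{A}=(Q_1,\dots,Q_D)\cdot\mathcal{G}$ with $\mathcal{G}\in\mathbb{R}^{m_1\times\dots\times m_D}$ and each $Q_d\in\mathbb{R}^{n_d\times m_d}$ having orthonormal columns. Let $\mathcal{A}=\mathcal{A}_1+\dots+\mathcal{A}_R$ with $\mathcal{A}_r\in\mathcal{M}_r^{n_1,\dots,n_D}$ and $\mathcal{G}=\mathcal{G}_1+\dots+\mathcal{G}_R$ with $\mathcal{G}_r\in\mathcal{M}_r^{m_1,\dots,m_D}$ be structured block term decompositions related by $\mathcal{A}_r=(Q_1,\dots,Q_D)\cdot\mathcal{G}_r$ for each $r=1,\dots,R$. Then $$\kappa^{\mathrm{SBTD}}(\mathcal{A}_1,\dots,\mathcal{A}_R)=\kappa^{\mathrm{SBTD}}(\mathcal{G}_1,\dots,\mathcal{G}_R).$$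
   Context: For matrices $A_d\in\mathbb{R}^{k_d\times l_d}$ and $\mathcal{C}=(c_{i_1\dots i_D})$, $(A_1,\dots,A_D)\cdot\mathcal{C}:=\sum c_{i_1\dots i_D}(A_1e_{i_1})\otimes\dots\otimes(A_De_{i_D})$. $\mathbb{R}^{n\times l}_\star$ denotes real $n\times l$ matrices of rank $l$. A Tucker core structure is a smooth submanifold $\mathcal{M}\subseteq\mathbb{R}^{l_1\times\dots\times l_D}$ such that every $\mathcal{C}\in\mathcal{M}$ has multilinear rank $(l_1,\dots,l_D)$ and $(A_1,\dots,A_D)\cdot\mathcal{C}\in\mathcal{M}$ for all $A_d\in\mathrm{GL}(l_d)$. For $k_d\ge l_d$, the structured Tucker manifold is $\mathcal{M}^{k_1,\dots,k_D}:=\{(U_1,\dots,U_D)\cdot\mathcal{C}:\mathcal{C}\in\mathcal{M},U_d\in\mathbb{R}^{k_d\times l_d}_\star\}$, a smooth embedded submanifold of $\mathbb{R}^{k_1\times\dots\times k_D}$. A structured block term decomposition (SBTD) of a tensor $\mathcal{B}$ is $\mathcal{B}=\mathcal{B}_1+\dots+\mathcal{B}_R$ with $\mathcal{B}_r\in\mathcal{M}_r^{k_1,\dots,k_D}$. Its condition number: let $T_r$ be a matrix whose columns form an orthonormal basis (Euclidean inner product) of the vectorized tangent space $T_{\mathcal{B}_r}\mathcal{M}_r^{k_1,\dots,k_D}$, let $T=[T_1\ \cdots\ T_R]$ (Terracini matrix) have $N$ columns, and set $\kappa^{\mathrm{SBTD}}(\mathcal{B}_1,\dots,\mathcal{B}_R):=1/\sigma_N(T)$,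 where $\sigma_N$ is the $N$-th largest singular value (taken $0$ if $N$ exceeds the number of rows) and $1/0=\infty$. This coincides with the condition number of the local inverse of the addition map $(\mathcal{B}_1,\dots,\mathcal{B}_R)\mapsto\sum_r\mathcal{B}_r$. *)

(* Defs.v *)
From HB Require Import structures.
From mathcomp Require Import all_boot all_order all_algebra.
From mathcomp Require Import all_classical all_reals all_analysis.
Set Implicit Arguments. Unset Strict Implicit. Unset Printing Implicit Defensive.
Import Order.TTheory GRing.Theory Num.Theory.
Import numFieldNormedType.Exports.
Local Open Scope classical_set_scope.
Local Open Scope ring_scope.

Section SBTD.
Variable R : realType.

Fixpoint dirder {V W : normedModType R} (vs : seq V) (f : V -> W) : V -> W :=
  match vs with
  | [::] => f
  | v :: vs' => fun x => derive (dirder vs' f) x v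
  end.

Definition smooth_on {V W : normedModType R} (U : set V) (f : V -> W) : Prop :=
  forall vs : seq V,
    (forall x, U x -> forall v, derivable (dirder vs f) x v) /\
    {within U, continuous (dirder vs f)}.

Definition is_submanifold (N : nat) (S : set 'cV[R]_N) : Prop :=
  forall p, S p ->
    exists (k : nat) (U : set 'cV[R]_N) (F : 'cV[R]_N -> 'cV[R]_k),
      [/\ open U, U p, smooth_on U F,
          U `&` S = U `&` (F @^-1` [set 0]) &
          forall x, U x -> S x -> forall w : 'cV[R]_k, exists v, derive F x v = w].

Definition tangent_space (N : nat) (S : set 'cV[R]_N) (p : 'cV[R]_N)
    : set 'cV[R]_N :=
  [set v | exists (e : R) (g : R -> 'cV[R]_N),
     [/\ 0 < e, smooth_on `]-e, e[ g,
         (forall t, -e < t < e -> S (g t)), g 0 = p & derive g 0 1 = v]].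

Definition Idx (D : nat) (l : 'I_D -> nat) : finType :=
  {dffun forall d : 'I_D, 'I_(l d)}.

Definition tensor (D : nat) (l : 'I_D -> nat) := 'cV[R]_#|Idx l|.

Definition tentry D (l : 'I_D -> nat) (C : tensor l) (i : Idx l) : R :=
  C (enum_rank i) 0.

Definition mktensor D (l : 'I_D -> nat) (f : Idx l -> R) : tensor l :=
  \col_(j < #|Idx l|) f (enum_val j).

Definition mlact D (k l : 'I_D -> nat) (A : forall d, 'M[R]_(k d, l d))
    (C : tensor l) : tensor k :=
  mktensor (fun j : Idx k =>
    \sum_(i : Idx l) tentry C i * \prod_(d < D) A d (j d) (i d)).

Definition idx_upd D (l : 'I_D -> nat) (i : Idx l) (d : 'I_D) (a : 'I_(l d))
    : Idx l := finfun (@dfwith _ (fun e => 'I_(l e)) (fun e => i e) d a).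

(* mode-d unfolding (columns = all mode-d fibres, possibly repeated) *)
Definition unfolding D (l : 'I_D -> nat) (d : 'I_D) (C : tensor l)
    : 'M[R]_(l d, #|Idx l|) :=
  \matrix_(a < l d, c < #|Idx l|) tentry C (idx_upd (enum_val c) a).

Definition has_mlrank D (l : 'I_D -> nat) (C : tensor l) : Prop :=
  forall d, \rank (unfolding d C) = l d.

Definition tucker_core_structure D (l : 'I_D -> nat) (M : set (tensor l))
    : Prop :=
  [/\ is_submanifold M,
      forall C, M C -> has_mlrank C &
      forall C, M C -> forall A : forall d, 'M[R]_(l d),
        (forall d, A d \in unitmx) -> M (mlact A C)].

Definition structured_tucker D (l : 'I_D -> nat) (M : set (tensor l))
    (k : 'I_D -> nat) : set (tensor k) :=
  [set X | exists (C : tensor l) (U : forall d, 'M[R]_(k d, l d)),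
     [/\ M C, forall d, \rank (U d) = l d & X = mlact U C]].

Definition onb_of (P Nc : nat) (S : set 'cV[R]_P) (T : 'M[R]_(P, Nc)) : Prop :=
  T^T *m T = 1%:M /\ forall v, S v <-> exists x : 'cV[R]_Nc, v = T *m x.

(* sigma_N(T) for T with N columns: square root of the smallest eigenvalue
   of T^T T (this is 0 when N exceeds the number of rows) *)
Definition sigma_last (P Nc : nat) (T : 'M[R]_(P, Nc)) : R :=
  Num.sqrt (inf [set mu | eigenvalue (T^T *m T) mu]).

Definition inv_sigma (P Nc : nat) (T : 'M[R]_(P, Nc)) : \bar R :=
  if sigma_last T == 0 then +oo%E else ((sigma_last T)^-1)%:E.

(* kappa^SBTD computed from the orthonormal tangent bases Ts r *)
Definition kappa_terracini (P nR : nat) (Nc : 'I_nR -> nat)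
    (Ts : forall r, 'M[R]_(P, Nc r)) : \bar R :=
  inv_sigma (\mxrow_(r < nR) Ts r).

End SBTD.
Arguments structured_tucker {R D l} M k.

(* Main.v *)
Require Import Defs.
From HB Require Import structures.
From mathcomp Require Import all_boot all_order all_algebra.
From mathcomp Require Import all_classical all_reals all_analysis.
From mathcomp Require Import ring.
Import Order.TTheory GRing.Theory Num.Theory.
Import numFieldNormedType.Exports.
Local Open Scope classical_set_scope.
Local Open Scope ring_scope.

Set Implicit Arguments.
Unset Strict Implicit.
Unset Printing Implicit Defensive.

(** Write [L = Q_1 (x) ... (x) Q_D], an isometry, and [K_d = 1 - Q_d Q_d^T].
    The rank of the unfoldings is lower semicontinuous, so [L] and [L^T] map the
    tangent spaces at [G_r] and [A_r] into each other.  A matrix curve of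
    bounded rank has a velocity whose compression between the two kernels of the
    base point vanishes; for a tangent vector [v] at [A_r] this yields
    [K_d v = E A_r] (acting in mode [d]), so that [K_d K_e v = 0] for [d <> e]
    and [v = L L^T v + sum_d K_d v] is an orthogonal sum.  Each row of the
    component [sum_r E_r A_r] has the inner products of a sum of vectors
    [B_r G_r] tangent at [G_r].  Hence a lower bound
    [c sum_r |x_r|^2 <= |sum_r x_r|^2] valid on the tangent spaces at the [G_r]
    holds at the [A_r] as well, and the best such [c] is the square of the least
    singular value of the Terracini matrix. *)

(** * Multilinear action, unfoldings and mode products *)

Section MultilinearAction.
Variable R : realType.

Lemma tentryK D (l : 'I_D -> nat) (f : Idx l -> R) i :
  tentry (mktensor f) i = f i.
Proof. by rewrite /tentry mxE enum_rankK. Qed.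

Lemma tensorP D (l : 'I_D -> nat) (X Y : tensor R l) :
  (forall i, tentry X i = tentry Y i) -> X = Y.
Proof.
by move=> eXY; apply/colP => j; rewrite -[j]enum_valK; exact: eXY.
Qed.

Lemma tentry_mlact D (k l : 'I_D -> nat) (A : forall d, 'M[R]_(k d, l d)) X j :
  tentry (mlact A X) j = \sum_i tentry X i * \prod_(d < D) A d (j d) (i d).
Proof. exact: tentryK. Qed.

Lemma tentryD D (l : 'I_D -> nat) (X Y : tensor R l) i :
  tentry (X + Y) i = tentry X i + tentry Y i.
Proof. by rewrite /tentry mxE. Qed.

Lemma tentryZ D (l : 'I_D -> nat) a (X : tensor R l) i :
  tentry (a *: X) i = a * tentry X i.
Proof. by rewrite /tentry mxE. Qed.

Lemma mlact_is_linear D (k l : 'I_D -> nat) (A : forall d, 'M[R]_(k d, l d)) :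
  linear (mlact A).
Proof.
move=> a X Y; apply/tensorP => j.
rewrite tentryD tentryZ !tentry_mlact mulr_sumr -big_split.
by apply: eq_bigr => i _; rewrite tentryD tentryZ mulrDl mulrA.
Qed.

HB.instance Definition _ D (k l : 'I_D -> nat) (A : forall d, 'M[R]_(k d, l d)) :=
  GRing.isLinear.Build R (tensor R l) (tensor R k) _ (mlact A)
    (mlact_is_linear A).

Lemma eq_mlact D (k l : 'I_D -> nat) (A B : forall d, 'M[R]_(k d, l d)) :
  (forall d, A d = B d) -> mlact A =1 mlact B.
Proof.
move=> eAB X; apply/tensorP => j; rewrite !tentry_mlact.
by apply: eq_bigr => i _; congr (_ * _); apply: eq_bigr => d _; rewrite eAB.
Qed.

(** The ranges ['I_(l d)] vary with [d], so they are placed as fibres of one tagged union, where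
    distributivity over a single type applies; the resulting families are identified with [Idx l]
    through [dffun_of_fprod]. *)
Lemma bigA_distr_dffun (D : nat) (l : 'I_D -> nat) (F : forall d, 'I_(l d) -> R) :
  \prod_(d < D) \sum_(a < l d) F d a = \sum_(i : Idx l) \prod_(d < D) F d (i d).
Proof.
pose P d : {ffun 'I_(l d) -> R} := [ffun a => F d a].
transitivity (\prod_(d < D) \sum_(u in tagged_with (fun d => 'I_(l d)) d)
    untag 0 (P d) u).
  apply: eq_bigr => d _.
  rewrite -(big_tag (T_ := fun d => 'I_(l d)) (fun d a => P d a)).
  by apply: eq_bigr => a _; rewrite ffunE.
rewrite bigA_distr_big_dep -big_fprod (reindex (@dffun_of_fprod _ _)); last first.
  exact/onW_bij/dffun_of_fprod_bij.
by apply: eq_bigr => f _; apply: eq_bigr => d _; rewrite !ffunE.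
Qed.

Lemma mlactM D (k l m : 'I_D -> nat) (A : forall d, 'M[R]_(k d, l d))
    (B : forall d, 'M[R]_(l d, m d)) X :
  mlact A (mlact B X) = mlact (fun d => A d *m B d) X.
Proof.
apply/tensorP => j; rewrite !tentry_mlact.
under eq_bigr do rewrite tentry_mlact mulr_suml.
rewrite exchange_big; apply: eq_bigr => i _ /=.
under [in RHS]eq_bigr do rewrite mxE.
rewrite bigA_distr_dffun mulr_sumr; apply: eq_bigr => i' _.
by rewrite -mulrA -big_split; congr (_ * _); apply: eq_bigr => d _; rewrite mulrC.
Qed.

Lemma mlact1 D (l : 'I_D -> nat) (X : tensor R l) : mlact (fun=> 1%:M) X = X.
Proof.
apply/tensorP => j; rewrite tentry_mlact (bigD1 j)//= [\prod_(_ < _) _]big1.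
  rewrite mulr1 big1 ?addr0// => i neij.
  have /existsP[d ned] : [exists d, j d != i d].
    apply: contraNT neij; rewrite negb_exists => /forallP eij.
    by apply/eqP/ffunP => d; have /negPn/eqP := eij d.
  by rewrite (bigD1 d)//= !mxE (negPf ned) mul0r mulr0.
by move=> d _; rewrite mxE eqxx.
Qed.

Definition tdot D (l : 'I_D -> nat) (X Y : tensor R l) : R :=
  \sum_(i : Idx l) tentry X i * tentry Y i.

Lemma tdotE D (l : 'I_D -> nat) (X Y : tensor R l) : tdot X Y = (X^T *m Y) 0 0.
Proof.
rewrite mxE /tdot (reindex (@enum_val (Idx l) predT))/=; last first.
  by exists enum_rank => ? _; [exact: enum_valK|exact: enum_rankK].
by apply: eq_bigr => j _; rewrite /tentry enum_valK mxE.
Qed.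

Lemma tdot_mlact D (k l : 'I_D -> nat) (A : forall d, 'M[R]_(k d, l d)) X Y :
  tdot (mlact A X) Y = tdot X (mlact (fun d => (A d)^T) Y).
Proof.
rewrite /tdot; under eq_bigr do rewrite tentry_mlact mulr_suml.
rewrite exchange_big; apply: eq_bigr => i _ /=.
rewrite tentry_mlact mulr_sumr; apply: eq_bigr => j _.
rewrite -mulrA; congr (_ * _).
rewrite mulrC; congr (_ * _); by apply: eq_bigr => d _; rewrite mxE.
Qed.

Lemma idx_upd_eq D (l : 'I_D -> nat) (i : Idx l) d (a : 'I_(l d)) :
  idx_upd i a d = a.
Proof. by rewrite ffunE dfwithin. Qed.

Lemma idx_upd_neq D (l : 'I_D -> nat) (i : Idx l) d (a : 'I_(l d)) e :
  e != d -> idx_upd i a e = i e.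
Proof. by move=> ned; rewrite ffunE dfwithout// eq_sym. Qed.

Lemma idx_upd_upd D (l : 'I_D -> nat) (i : Idx l) d (a b : 'I_(l d)) :
  idx_upd (idx_upd i a) b = idx_upd i b.
Proof.
apply/ffunP => e; have [->|ned] := eqVneq e d; first by rewrite !idx_upd_eq.
by rewrite !idx_upd_neq.
Qed.

Lemma idx_upd_id D (l : 'I_D -> nat) (i : Idx l) d : idx_upd i (i d) = i.
Proof.
apply/ffunP => e; have [->|ned] := eqVneq e d; first by rewrite !idx_upd_eq.
by rewrite !idx_upd_neq.
Qed.

(** Resetting coordinate [d] to [a] is a bijection from the slice at [b] onto the slice at [a]; the
    slice at [b] thus parametrizes all mode-[d] fibres. *)
Lemma sum_idx_fiber D (l : 'I_D -> nat) d (b : 'I_(l d)) (F : Idx l -> R) :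
  \sum_i F i = \sum_(a < l d) \sum_(i : Idx l | i d == b) F (idx_upd i a).
Proof.
rewrite (partition_big (fun i : Idx l => i d) predT)//=.
apply: eq_bigr => a _.
rewrite (reindex_onto (fun i : Idx l => idx_upd i a) (fun i => idx_upd i b)).
  apply: eq_bigl => i; rewrite idx_upd_eq eqxx idx_upd_upd /=.
  by apply/eqP/eqP => [<-|<-]; rewrite ?idx_upd_eq// idx_upd_id.
by move=> i /eqP <-; rewrite idx_upd_upd idx_upd_id.
Qed.

Lemma unfoldingE D (l : 'I_D -> nat) d (X : tensor R l) i :
  tentry X i = unfolding d X (i d) (enum_rank i).
Proof. by rewrite mxE enum_rankK idx_upd_id. Qed.

Lemma unfolding_inj D (l : 'I_D -> nat) d : injective (@unfolding R D l d).
Proof. by move=> X Y eXY; apply/tensorP => i; rewrite !(unfoldingE d) eXY. Qed.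

Lemma prod_idx_upd D (k l : 'I_D -> nat) (U : forall d, 'M[R]_(k d, l d))
    d (a : 'I_(k d)) (i : Idx k) (j : Idx l) :
  \prod_(e < D) U e (idx_upd i a e) (j e) =
  U d a (j d) * \prod_(e < D | e != d) U e (i e) (j e).
Proof.
rewrite (bigD1 d)//= idx_upd_eq; congr (_ * _).
by apply: eq_bigr => e ned; rewrite idx_upd_neq.
Qed.

(** [K] collects the action in the remaining modes; the factor [U d] on the left is what bounds
    ranks and lets a projector in mode [d] annihilate the result. *)
Lemma unfolding_mlact D (k l : 'I_D -> nat) (U : forall d, 'M[R]_(k d, l d))
    d (X : tensor R l) :
  exists K, unfolding d (mlact U X) = U d *m unfolding d X *m K.
Proof.
(* [unfolding] repeats each mode-[d] fibre once per value of coordinate [d]; fixing a value [b]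
   selects one copy. If [l d = 0] there is no index and both sides vanish. *)
case: (pickP (fun _ : 'I_(l d) => true)) => [b _|l0]; last first.
  exists 0; apply/matrixP => a c; rewrite mulmx0 !mxE tentry_mlact big1// => i _.
  by have := l0 (i d).
pose w (c : Idx k) (i : Idx l) := \prod_(e < D | e != d) U e (c e) (i e).
exists (\matrix_(j, c) (((enum_val j : Idx l) d == b)%:R *
   w (enum_val c) (enum_val j))).
apply/matrixP => a c; rewrite -mulmxA !mxE tentry_mlact (sum_idx_fiber b).
apply: eq_bigr => a' _; rewrite mxE mulr_sumr.
rewrite (reindex (@enum_val (Idx l) predT))/=; last first.
  by exists enum_rank => ? _; [exact: enum_valK|exact: enum_rankK].
rewrite big_mkcond; apply: eq_bigr => j _; rewrite !mxE.
case: eqP => _; last by rewrite mul0r !mulr0.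
rewrite mul1r prod_idx_upd idx_upd_eq mulrCA; do 2!congr (_ * _).
by apply: eq_bigr => e ned; rewrite idx_upd_neq.
Qed.

Lemma rank_unfolding_mlact D (k l : 'I_D -> nat) (U : forall d, 'M[R]_(k d, l d))
    d (X : tensor R l) :
  (\rank (unfolding d (mlact U X)) <=
   minn (\rank (U d)) (\rank (unfolding d X)))%N.
Proof.
have [K ->] := unfolding_mlact U d X; rewrite (leq_trans (mxrankM_maxl _ _))//.
by rewrite leq_min mxrankM_maxl mxrankM_maxr.
Qed.

Definition dfmode D (k l : 'I_D -> nat) (U : forall d, 'M[R]_(k d, l d))
    d (N : 'M[R]_(k d, l d)) : forall e, 'M[R]_(k e, l e) :=
  @dfwith _ (fun e => 'M[R]_(k e, l e)) U d N.

(** The mode-[d] product of tensor calculus. *)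
Definition mode D (l : 'I_D -> nat) d (N : 'M[R]_(l d)) (X : tensor R l)
    : tensor R l :=
  mlact (dfmode (fun e => 1%:M) N) X.

HB.instance Definition _ D (l : 'I_D -> nat) d (N : 'M[R]_(l d)) :=
  GRing.isLinear.Build R (tensor R l) (tensor R l) _ (mode N)
    (mlact_is_linear _).

Lemma dfmode_eq D (k l : 'I_D -> nat) (U : forall d, 'M[R]_(k d, l d))
    d (N : 'M[R]_(k d, l d)) : dfmode U N d = N.
Proof. exact: dfwithin. Qed.

Lemma dfmode_neq D (k l : 'I_D -> nat) (U : forall d, 'M[R]_(k d, l d))
    d (N : 'M[R]_(k d, l d)) e : e != d -> dfmode U N e = U e.
Proof. by move=> ned; rewrite /dfmode dfwithout// eq_sym. Qed.

Lemma unfolding_mode D (l : 'I_D -> nat) d (N : 'M[R]_(l d)) X :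
  unfolding d (mode N X) = N *m unfolding d X.
Proof.
apply/matrixP => a c; rewrite !mxE tentry_mlact.
rewrite (sum_idx_fiber (enum_val c d)); apply: eq_bigr => b _.
rewrite (bigD1 (enum_val c))//= [X in _ + X]big1 ?addr0; last first.
  move=> i /andP[/eqP eid neic].
  have /existsP[e nee] : [exists e, i e != enum_val c e].
    apply: contraNT neic; rewrite negb_exists => /forallP eic.
    by apply/eqP/ffunP => e; have /negPn/eqP := eic e.
  have ned : e != d by apply: contraNneq nee => ->; rewrite eid.
  rewrite prod_idx_upd (bigD1 e)//= (dfmode_neq _ _ ned) mxE.
  by rewrite (idx_upd_neq _ _ ned) [_ == i e]eq_sym (negPf nee) mul0r !mulr0.
rewrite prod_idx_upd dfmode_eq idx_upd_eq big1 ?mulr1; first by rewrite mxE mulrC.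
by move=> e ned; rewrite (dfmode_neq _ _ ned) mxE (idx_upd_neq _ _ ned) eqxx.
Qed.

Lemma modeD D (l : 'I_D -> nat) d (N N' : 'M[R]_(l d)) X :
  mode (N + N') X = mode N X + mode N' X.
Proof.
apply: (@unfolding_inj _ _ d); rewrite unfolding_mode mulmxDl -!unfolding_mode.
by apply/matrixP => a c; rewrite !mxE tentryD.
Qed.

Lemma modeB D (l : 'I_D -> nat) d (N N' : 'M[R]_(l d)) X :
  mode (N - N') X = mode N X - mode N' X.
Proof. by apply/eqP; rewrite eq_sym subr_eq -modeD subrK. Qed.

Lemma mode1 D (l : 'I_D -> nat) d (X : tensor R l) : @mode D l d 1%:M X = X.
Proof. by apply: (@unfolding_inj _ _ d); rewrite unfolding_mode mul1mx. Qed.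

Lemma mode_comm D (l : 'I_D -> nat) d e (N : 'M[R]_(l d)) (N' : 'M[R]_(l e)) X :
  d != e -> mode N (mode N' X) = mode N' (mode N X).
Proof.
move=> nde; rewrite /mode !mlactM; apply: eq_mlact => c.
have [->|ncd] := eqVneq c d.
  by rewrite !dfmode_eq !(dfmode_neq _ _ nde) mulmx1 mul1mx.
by rewrite !(dfmode_neq _ _ ncd) mulmx1 mul1mx.
Qed.

End MultilinearAction.

(** * Limits of matrix expressions along a filter *)

Section MatrixLimits.
Variables (R : realType) (T : Type) (F : set_system T).
Context {FF : Filter F}.

Lemma cvg_mx m n (f : T -> 'M[R]_(m, n)) (a : 'M[R]_(m, n)) :
  (forall i j, f x i j @[x --> F] --> a i j) -> f x @[x --> F] --> a.
Proof.
move=> fa; apply/cvgrPdist_le => /= e e0; near=> x.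
rewrite /Num.Def.normr/= mx_normrE (bigmax_le _ (ltW e0))//= => i _.
rewrite !mxE; move: i; near: x; apply: filter_forall => /= i.
by move/cvgrPdist_le : (fa i.1 i.2); exact.
Unshelve. all: by end_near. Qed.

Lemma cvg_coord m n (f : T -> 'M[R]_(m, n)) (a : 'M[R]_(m, n)) i j :
  f x @[x --> F] --> a -> f x i j @[x --> F] --> a i j.
Proof.
by move=> fa; exact: (cvg_comp _ _ fa (@coord_continuous R m n i j a)).
Qed.

Lemma cvg_mulmx m n p (f : T -> 'M[R]_(m, n)) (g : T -> 'M[R]_(n, p))
    (a : 'M[R]_(m, n)) (b : 'M[R]_(n, p)) :
  f x @[x --> F] --> a -> g x @[x --> F] --> b ->
  f x *m g x @[x --> F] --> a *m b.
Proof.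
move=> fa gb; apply: cvg_mx => i j; rewrite mxE.
under eq_fun do rewrite mxE.
apply: cvg_big => [|k _]; first exact: add_continuous.
by apply: cvgM; exact: cvg_coord.
Qed.

Lemma cvg_det n (f : T -> 'M[R]_n) (a : 'M[R]_n) :
  f x @[x --> F] --> a -> \det (f x) @[x --> F] --> \det a.
Proof.
move=> fa; rewrite /determinant.
apply: cvg_big => [|s _]; first exact: add_continuous.
apply: cvgM; first exact: cvg_cst.
apply: cvg_big => [|i _]; first exact: mul_continuous.
exact: cvg_coord.
Qed.

Lemma cvg_adj n (f : T -> 'M[R]_n) (a : 'M[R]_n) :
  f x @[x --> F] --> a -> \adj (f x) @[x --> F] --> \adj a.
Proof.
move=> fa; apply: cvg_mx => i j; rewrite mxE /cofactor.
under eq_fun do rewrite mxE /cofactor.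
apply: cvgM; first exact: cvg_cst.
apply: cvg_det; apply: cvg_mx => k l; rewrite !mxE.
by under eq_fun do rewrite !mxE; exact: cvg_coord.
Qed.

End MatrixLimits.

(** * Rank near a limit point and velocities of curves of bounded rank *)

Section RankBoundedCurves.
Variable R : realType.

(** The invertible compression forces [Z *m X] to have rank [r], so its row space is all of that of
    [X]. Hence [X = K *m (Z *m X)], and multiplying by [B] determines [K]. *)
Lemma rank_factorization p q r (X : 'M[R]_(p, q)) (Z : 'M[R]_(r, p))
    (B : 'M[R]_(q, r)) :
  (\rank X <= r)%N -> Z *m X *m B \in unitmx ->
  X = X *m B *m invmx (Z *m X *m B) *m (Z *m X).
Proof.
move=> rX uM.
have rZX : \rank (Z *m X) = r.
  apply/eqP; rewrite eqn_leq rank_leq_row -{1}(mxrank_unit uM).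
  exact: mxrankM_maxl.
have /submxP[K eX] : (X <= Z *m X)%MS.
  have [le <-] := mxrank_leqif_sup (submxMl Z X).
  by rewrite eqn_leq le rZX rX.
have eXB : X *m B = K *m (Z *m X *m B) by rewrite mulmxA -eX.
by rewrite eXB mulmxK.
Qed.

(** Take a left inverse of the column base and a right inverse of the row base of [X]. *)
Lemma unit_minor p q (X : 'M[R]_(p, q)) :
  exists (Z : 'M[R]_(\rank X, p)) (B : 'M[R]_(q, \rank X)), Z *m X *m B = 1%:M.
Proof.
have /row_fullP[Z eZ] := col_base_full X.
have /row_freeP[B eB] := row_base_free X.
exists Z, B; have -> : Z *m X = row_base X; last by [].
by rewrite -[RHS]mul1mx -eZ -mulmxA mulmx_base.
Qed.

(** The compression that is the identity at [X0] has determinant tending to 1, so it stays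
    invertible nearby and bounds the rank from below. *)
Lemma rank_lower_semicontinuous (T : Type) (F : set_system T) {FF : Filter F}
    p q (X : T -> 'M[R]_(p, q)) (X0 : 'M[R]_(p, q)) :
  X x @[x --> F] --> X0 -> \forall x \near F, (\rank X0 <= \rank (X x))%N.
Proof.
move=> XX0; have [Z [B ZB]] := unit_minor X0.
have : \det (Z *m X x *m B) @[x --> F] --> (1 : R).
  rewrite -(det1 _ (\rank X0)) -ZB.
  by apply: cvg_det; apply: cvg_mulmx; [apply: cvg_mulmx => //|]; exact: cvg_cst.
move/cvgr_neq0 => /(_ (oner_neq0 _)).
apply: filterS => x nz.
have : Z *m X x *m B \in unitmx by rewrite unitmxE unitfE.
by move/mxrank_unit <-; rewrite (leq_trans (mxrankM_maxl _ _))// mxrankM_maxr.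
Qed.

(* With [M = Z X B] invertible, [rank X <= rank X0] makes
   [det M * (u X z) = u X B (adj M) Z X z]; both factors [u X] and [X z] of the
   right-hand side vanish at [X0], so dividing by [h] leaves [u V z = 0]. *)
Lemma rank_bounded_derivative (F : set_system R) {FF : ProperFilter F}
    p q a b (X Y : R -> 'M[R]_(p, q)) (X0 V : 'M[R]_(p, q))
    (u : 'M[R]_(a, p)) (z : 'M[R]_(q, b)) :
  X h @[h --> F] --> X0 -> Y h @[h --> F] --> V ->
  (\forall h \near F, h != 0) ->
  (\forall h \near F, X h = X0 + h *: Y h) ->
  (\forall h \near F, (\rank (X h) <= \rank X0)%N) ->
  u *m X0 = 0 -> X0 *m z = 0 -> u *m V *m z = 0.
Proof.
move=> XX0 YV n0 XY rX uX0 X0z.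
have [Z [B ZB]] := unit_minor X0.
pose M h := Z *m X h *m B.
have MM : M h @[h --> F] --> (1%:M : 'M[R]_(\rank X0)).
  rewrite -ZB.
  by apply: cvg_mulmx; [apply: cvg_mulmx => //|]; exact: cvg_cst.
have dM : \det (M h) @[h --> F] --> (1 : R).
  by rewrite -(det1 _ (\rank X0)); apply: cvg_det.
have lhs : \det (M h) *: (u *m Y h *m z) @[h --> F] --> 1 *: (u *m V *m z).
  apply: cvgZ => //.
  by apply: cvg_mulmx; [apply: cvg_mulmx => //|]; exact: cvg_cst.
have rhs : u *m Y h *m B *m \adj (M h) *m (Z *m (X h *m z)) @[h --> F] -->
    u *m V *m B *m \adj (1%:M : 'M[R]_(\rank X0)) *m (Z *m (X0 *m z)).
  apply: cvg_mulmx; last first.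
    apply: cvg_mulmx; first exact: cvg_cst.
    by apply: cvg_mulmx => //; exact: cvg_cst.
  apply: cvg_mulmx; last exact: cvg_adj.
  apply: cvg_mulmx; last exact: cvg_cst.
  by apply: cvg_mulmx => //; exact: cvg_cst.
rewrite X0z !mulmx0 in rhs; rewrite scale1r in lhs.
apply: (cvg_unique _ lhs); first exact: norm_hausdorff.
apply: cvg_trans rhs; apply: near_eq_cvg.
have nz : \forall h \near F, \det (M h) != 0.
  by move/cvgr_neq0 : dM => /(_ (oner_neq0 _)).
near=> h.
have dh : \det (M h) \is a GRing.unit.
  by rewrite unitfE; near: h.
have uM : M h \in unitmx by rewrite unitmxE.
have h0 : h != 0 by near: h.
have rh : (\rank (X h) <= \rank X0)%N by near: h.
have := rank_factorization rh uM; rewrite -/(M h) => eX.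
have uXh : u *m X h = h *: (u *m Y h).
  have -> : X h = X0 + h *: Y h by near: h.
  by rewrite mulmxDr uX0 add0r -scalemxAr.
have key : \det (M h) *: (u *m X h *m z) =
    u *m X h *m B *m \adj (M h) *m (Z *m (X h *m z)).
  rewrite {1}eX /invmx uM -!scalemxAr -!scalemxAl -scalemxAr -scalemxAl.
  by rewrite scalerA mulrV// scale1r !mulmxA.
move: key; rewrite uXh -!scalemxAl scalerA mulrC -scalerA => key.
by apply: (scalerI h0); rewrite key.
Unshelve. all: by end_near. Qed.

End RankBoundedCurves.

(** * Smooth curves and their images under linear maps *)

Section SmoothCurves.
Variable R : realType.

Lemma cvg_linear (T : Type) (F : set_system T) {FF : Filter F} p q
    (L : {linear 'cV[R]_p -> 'cV[R]_q}) (f : T -> 'cV[R]_p) (a : 'cV[R]_p) :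
  f x @[x --> F] --> a -> L (f x) @[x --> F] --> L a.
Proof.
move=> fa; pose B : 'M[R]_(q, p) := \matrix_(i, j) L (delta_mx j 0) i 0.
have LB x : L x = B *m x.
  rewrite {1}[x]matrix_sum_delta linear_sum; apply/colP => i.
  rewrite summxE mxE; apply: eq_bigr => j _.
  by rewrite big_ord1 linearZ !mxE mulrC.
rewrite LB; under eq_fun do rewrite LB.
by apply: cvg_mulmx => //; exact: cvg_cst.
Qed.

Arguments cvg_linear {T F FF p q} L {f a}.

Lemma derive_linear (V : normedModType R) p q
    (L : {linear 'cV[R]_p -> 'cV[R]_q}) (f : V -> 'cV[R]_p) x v :
  derivable f x v ->
  derivable (L \o f) x v /\ 'D_v (L \o f) x = L ('D_v f x).
Proof.
move=> fxv.
have : h^-1 *: ((L \o f) (h *: v + x) - (L \o f) x) @[h --> 0^'] --> L ('D_v f x).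
  apply: cvg_trans (cvg_linear L fxv); apply: near_eq_cvg; near=> h.
  by rewrite /= linearZ linearB.
move=> Lf.
split; first by apply/cvg_ex; exists (L ('D_v f x)).
exact: (cvg_lim (@norm_hausdorff _ _) Lf).
Unshelve. all: by end_near. Qed.

Arguments derive_linear {V p q} L {f x v}.

Lemma smooth_onS (V W : normedModType R) (U U' : set V) (f : V -> W) :
  U' `<=` U -> smooth_on U f -> smooth_on U' f.
Proof.
move=> sU sf vs; have [df cf] := sf vs; split; first by move=> x /sU; exact: df.
exact: (continuous_subspaceW sU).
Qed.

(** Iterated directional derivatives commute with [L]. The induction knows this on [U] only;
    openness of [U] turns it into an equality near each point, which can be differentiated again. *)
Lemma smooth_on_linear (V : normedModType R) p q
    (L : {linear 'cV[R]_p -> 'cV[R]_q}) (U : set V) (f : V -> 'cV[R]_p) :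
  open U -> smooth_on U f -> smooth_on U (L \o f).
Proof.
move=> oU sf.
have eL vs x : U x -> dirder vs (L \o f) x = L (dirder vs f x).
  elim: vs x => [//|v vs IH] x Ux /=.
  rewrite -(derive_linear L ((sf vs).1 x Ux v)).2.
  apply: near_eq_derive; apply: filterS (open_nbhs_nbhs (conj oU Ux)).
  exact: IH.
move=> vs; have [df cf] := sf vs; split.
  move=> x Ux v; have := (derive_linear L (df x Ux v)).1.
  apply: near_eq_derivable.
  by apply: filterS (open_nbhs_nbhs (conj oU Ux)) => y Uy /=; rewrite eL.
move: cf; rewrite !continuous_open_subspace// => cf x xU.
have Ux : U x by move: xU; rewrite inE.
rewrite /continuous_at /= (eL _ _ Ux).
apply: cvg_trans (cvg_linear L (cf x xU)); apply: near_eq_cvg.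
by apply: filterS (open_nbhs_nbhs (conj oU Ux)) => y Uy /=; rewrite eL.
Qed.

Lemma smooth_on_affine (N : nat) (U : set R) (a b : 'cV[R]_N) :
  smooth_on U (fun t : R => a + t *: b).
Proof.
(* The quotient is constant for [h != 0]. The summand 0 keeps the limit in the affine form with zero
   slope, the shape preserved by the induction on [vs]. *)
have der (a' b' : 'cV[R]_N) (x v : R) :
    h^-1 *: ((a' + (h *: v + x) *: b') - (a' + x *: b')) @[h --> (0 : R)^'] -->
    v *: b' + 0.
  apply: (cvg_near_cst _); near=> h.
  have h0 : h != 0 by near: h; exact: nbhs_dnbhs_neq.
  rewrite opprD addrACA subrr add0r scalerDl addrK addr0 scalerA.
  by rewrite -[h *: v]/(h * v) mulKf.
have aux vs : exists a' b',
    dirder vs (fun t : R => a + t *: b) = (fun t => a' + t *: b').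
  elim: vs => [|v vs [a' [b' IH]]]; first by exists a, b.
  exists (v *: b'), 0; apply/funext => t /=; rewrite IH scaler0.
  exact: (cvg_lim (@norm_hausdorff _ _) (der a' b' t v)).
move=> vs; have [a' [b' ->]] := aux vs; split.
  by move=> x _ v; apply/cvg_ex; eexists; exact: (der a' b' x v).
apply: continuous_subspaceT => x.
apply: cvgD; first exact: cvg_cst.
by apply: cvgZ; [exact: cvg_id|exact: cvg_cst].
Unshelve. all: by end_near. Qed.

(** Extracts the first-order data of a tangent curve in the punctured-limit form that
    [rank_bounded_derivative] takes. *)
Lemma tangent_space_limits N (S : set 'cV[R]_N) p v : tangent_space S p v ->
  exists g : R -> 'cV[R]_N, [/\ g h @[h --> 0^'] --> p,
    h^-1 *: (g h - p) @[h --> 0^'] --> v & \forall h \near 0^', S (g h)].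
Proof.
move=> [e [g [e0 sg Sg <- <-]]]; exists g.
have I0 : `]-e, e[%classic (0 : R) by rewrite /= in_itv/= oppr_lt0 e0.
have [/(_ 0 I0 1) dg cg] := sg [::]; split.
- have : {in `]-e, e[%classic, continuous g}.
    by rewrite -continuous_open_subspace//; exact: interval_open.
  move=> /(_ 0); rewrite inE => /(_ I0) g0.
  by apply: cvg_trans g0; apply: cvg_app; exact: nbhs_dnbhs.
- have : h^-1 *: (g (h *: 1 + 0) - g 0) @[h --> 0^'] --> 'D_1 g 0 := dg.
  by under eq_fun do rewrite addr0 [_ *: 1]mulr1.
near=> h; apply: Sg; rewrite -ltr_norml; near: h.
exact: dnbhs0_lt.
Unshelve. all: by end_near. Qed.

(** Compose the curve with [L]. Since [L] is only known to send [S] into [S'] near [x], the interval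
    is shrunk until the curve stays in that neighbourhood. *)
Lemma tangent_space_linear p q (L : {linear 'cV[R]_p -> 'cV[R]_q})
    (S : set 'cV[R]_p) (S' : set 'cV[R]_q) (x v : 'cV[R]_p) :
  (\forall y \near x, S y -> S' (L y)) ->
  tangent_space S x v -> tangent_space S' (L x) (L v).
Proof.
move=> SS' [e [g [e0 sg Sg gx <-]]]; rewrite -gx in SS' *.
have I0 : `]-e, e[%classic (0 : R) by rewrite /= in_itv/= oppr_lt0 e0.
have [/(_ 0 I0 1) dg cg] := sg [::].
have : {in `]-e, e[%classic, continuous g}.
  by rewrite -continuous_open_subspace//; exact: interval_open.
move=> /(_ 0); rewrite inE => /(_ I0) g0.
have : \forall t \near (0 : R), S (g t) -> S' (L (g t)) by exact: (g0 _ SS').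
move=> /nbhs_ballP[/= d d0 dS].
pose e' := Num.min e d.
have e'0 : 0 < e' by rewrite lt_min e0 d0.
have le' : `]-e', e'[ `<=` `]-e, e[.
  move=> t; rewrite /= !in_itv/= -!ltr_norml => /lt_le_trans; apply.
  by rewrite ge_min lexx.
exists e', (L \o g); split=> //.
- by apply: smooth_on_linear (smooth_onS le' sg); exact: interval_open.
- move=> t te'; apply: dS; last first.
    by apply: Sg; have := le' t; rewrite /= !in_itv; exact.
  rewrite /ball/= sub0r normrN; move: te'; rewrite -ltr_norml.
  move=> /lt_le_trans; apply.
  by rewrite ge_min lexx orbT.
- exact: (derive_linear L dg).2.
Qed.

Lemma tangent_space_affine N (S : set 'cV[R]_N) (x v : 'cV[R]_N) :
  (\forall t \near (0 : R), S (x + t *: v)) -> tangent_space S x v.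
Proof.
move=> /nbhs_ballP[e /= e0 eS].
exists e, (fun t => x + t *: v); split=> //.
- exact: smooth_on_affine.
- by move=> t te; apply: eS; rewrite /ball/= sub0r normrN ltr_norml.
- by rewrite scale0r addr0.
apply: (cvg_lim (@norm_hausdorff _ _)); apply: (cvg_near_cst _); near=> h.
have h0 : h != 0 by near: h; exact: nbhs_dnbhs_neq.
rewrite /= addr0 scale0r addr0 [x + _]addrC addrK scalerA.
by rewrite -[h *: 1]/(h * 1) mulr1 mulVf// scale1r.
Unshelve. all: by end_near. Qed.

End SmoothCurves.

(** * Ranks on, and tangent vectors to, structured Tucker manifolds *)

Section TuckerTangent.
Variables (R : realType) (D : nat) (l : 'I_D -> nat) (M : set (tensor R l)).
Hypothesis coreM : tucker_core_structure M.

(** The rank of [U d] gives the upper bound. For the lower one, the pseudoinverses recover the core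
    [C], which has full multilinear rank. *)
Lemma structured_tucker_rank (k : 'I_D -> nat) (X : tensor R k) d :
  structured_tucker M k X -> \rank (unfolding d X) = l d.
Proof.
move=> [C [U [MC rU ->]]]; apply/eqP; rewrite eqn_leq; apply/andP; split.
  have := rank_unfolding_mlact U d C.
  by rewrite leq_min rU => /andP[].
have [_ /(_ C MC d) rC _] := coreM.
have -> : l d = \rank (unfolding d (mlact (fun d => pinvmx (U d)) (mlact U C))).
  rewrite mlactM (eq_mlact (B := fun=> 1%:M)) ?mlact1 ?rC// => e.
  by rewrite mulVpmx// /row_full rU.
by have := rank_unfolding_mlact (fun d => pinvmx (U d)) d (mlact U C);
  rewrite leq_min => /andP[].
Qed.

(** The rank of the unfolding is at most that of [A d *m U d], so the assumption forces these new
    factors to have full column rank. *)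
Lemma structured_tucker_mlact (k k' : 'I_D -> nat)
    (A : forall d, 'M[R]_(k' d, k d)) X :
  structured_tucker M k X ->
  (forall d, (l d <= \rank (unfolding d (mlact A X)))%N) ->
  structured_tucker M k' (mlact A X).
Proof.
move=> [C [U [MC rU ->]]]; rewrite mlactM => rA.
exists C, (fun d => A d *m U d); split=> // d.
apply/eqP; rewrite eqn_leq rank_leq_col (leq_trans (rA d))//.
have := rank_unfolding_mlact (fun d => A d *m U d) d C.
by rewrite leq_min => /andP[].
Qed.

Lemma cvg_unfolding (T : Type) (F : set_system T) {FF : Filter F}
    (k : 'I_D -> nat) d (f : T -> tensor R k) (X : tensor R k) :
  f x @[x --> F] --> X -> unfolding d (f x) @[x --> F] --> unfolding d X.
Proof.
move=> fX; apply: cvg_mx => i j; rewrite mxE.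
by under eq_fun do rewrite mxE; exact: cvg_coord.
Qed.

(** By semicontinuity the unfoldings of [mlact A Y] keep rank at least [l d] for [Y] near [X], so
    [mlact A] maps the manifold near [X] into the target manifold. *)
Lemma tangent_space_mlact (k k' : 'I_D -> nat)
    (A : forall d, 'M[R]_(k' d, k d)) X v :
  structured_tucker M k' (mlact A X) ->
  tangent_space (structured_tucker M k) X v ->
  tangent_space (structured_tucker M k') (mlact A X) (mlact A v).
Proof.
move=> MAX; apply: tangent_space_linear.
have cA : mlact A Y @[Y --> X] --> mlact A X.
  exact: (@cvg_linear R _ _ (nbhs_filter X) _ _ (mlact A) _ X cvg_id).
have rA d : \forall Y \near X, (l d <= \rank (unfolding d (mlact A Y)))%N.
  rewrite -(structured_tucker_rank d MAX).
  apply: (@rank_lower_semicontinuous R _ _ (nbhs_filter X)).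
  exact: (@cvg_unfolding _ _ (nbhs_filter X) _ _ _ _ cA).
have := @filter_forall _ _ _ _ (nbhs_filter X) rA.
by apply: filterS => Y rY MY; exact: structured_tucker_mlact.
Qed.

(** It is the velocity of the line obtained by acting on [X] with [1 + t B] in mode [d], which stays
    in the manifold for small [t] because the ranks cannot drop. *)
Lemma tangent_space_mode (k : 'I_D -> nat) (X : tensor R k) d (B : 'M[R]_(k d)) :
  structured_tucker M k X ->
  tangent_space (structured_tucker M k) X (mode B X).
Proof.
move=> MX; apply: tangent_space_affine.
have eX t : X + t *: mode B X = mode (1%:M + t *: B) X.
  apply: (@unfolding_inj _ _ _ d); rewrite unfolding_mode mulmxDl mul1mx.
  rewrite -scalemxAl -unfolding_mode.
  by apply/matrixP => a c; rewrite !mxE tentryD tentryZ.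
have cX : X + t *: mode B X @[t --> (0 : R)] --> X.
  rewrite -[in Y in _ --> Y](addr0 X) -(scale0r (mode B X)).
  by apply: cvgD; [exact: cvg_cst|apply: cvgZ; [exact: cvg_id|exact: cvg_cst]].
have rX e : \forall t \near (0 : R),
    (l e <= \rank (unfolding e (X + t *: mode B X)%R))%N.
  rewrite -(structured_tucker_rank e MX).
  exact: (rank_lower_semicontinuous (cvg_unfolding (d := e) cX)).
have := @filter_forall _ _ _ _ (nbhs_filter (0 : R)) rX.
apply: filterS => t; rewrite eX => rtX.
exact: structured_tucker_mlact.
Qed.

(** All points of the manifold have mode-[d] rank [l d], so the unfolding of a curve in it never
    exceeds the rank at the base point. *)
Lemma tangent_space_kernels (k : 'I_D -> nat) (X v : tensor R k) d a b
    (u : 'M[R]_(a, k d)) (z : 'M[R]_(#|Idx k|, b)) :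
  structured_tucker M k X ->
  tangent_space (structured_tucker M k) X v ->
  u *m unfolding d X = 0 -> unfolding d X *m z = 0 -> u *m unfolding d v *m z = 0.
Proof.
move=> MX /tangent_space_limits[g [gX gv Mg]].
apply: (@rank_bounded_derivative _ (0 : R)^' _ _ _ _ _
  (fun h => unfolding d (g h)) (fun h => unfolding d (h^-1 *: (g h - X)))).
- exact: cvg_unfolding.
- exact: cvg_unfolding.
- exact: nbhs_dnbhs_neq.
- near=> h.
  have h0 : h != 0 by near: h; exact: nbhs_dnbhs_neq.
  apply/matrixP => i j; rewrite !mxE tentryZ mulrA mulfV// mul1r.
  by rewrite /tentry !mxE addrC subrK.
- near=> h; rewrite !structured_tucker_rank//.
  by near: h.
Unshelve. all: by end_near. Qed.

(** Taking the cokernel of the unfolding of [X] for [z] shows that the rows of [K *m unfolding d v]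
    lie in the row space of [unfolding d X]; [E] holds the coefficients. *)
Lemma tangent_space_mode_factor (k : 'I_D -> nat) (X v : tensor R k) d
    (K : 'M[R]_(k d)) :
  structured_tucker M k X ->
  tangent_space (structured_tucker M k) X v ->
  mode K X = 0 -> exists E : 'M[R]_(k d), mode K v = mode E X.
Proof.
move=> MX Tv KX.
have KX0 : K *m unfolding d X = 0.
  by rewrite -unfolding_mode KX; apply/matrixP => i j; rewrite !mxE /tentry mxE.
have := tangent_space_kernels MX Tv KX0 (mulmx_coker (unfolding d X)).
move/eqP; rewrite -submxE => /submxP[E eE]; exists E.
by apply: (@unfolding_inj _ _ _ d); rewrite !unfolding_mode.
Qed.

End TuckerTangent.

(** * The Euclidean inner product of tensors *)

Section InnerProduct.
Variables (R : realType) (D : nat) (k : 'I_D -> nat).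
Implicit Types X Y : tensor R k.

Lemma tdotC X Y : tdot X Y = tdot Y X.
Proof. by apply: eq_bigr => i _; rewrite mulrC. Qed.

Lemma tdot_suml (I : Type) (r : seq I) (P : pred I) (F : I -> tensor R k) Y :
  tdot (\sum_(i <- r | P i) F i) Y = \sum_(i <- r | P i) tdot (F i) Y.
Proof.
rewrite tdotE raddf_sum mulmx_suml summxE.
by apply: eq_bigr => i _; rewrite tdotE.
Qed.

Lemma tdot_sumr (I : Type) (r : seq I) (P : pred I) (F : I -> tensor R k) X :
  tdot X (\sum_(i <- r | P i) F i) = \sum_(i <- r | P i) tdot X (F i).
Proof. by rewrite tdotC tdot_suml; apply: eq_bigr => i _; rewrite tdotC. Qed.

Lemma tdotDr X Y Z : tdot X (Y + Z) = tdot X Y + tdot X Z.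
Proof. by rewrite !tdotE mulmxDr mxE. Qed.

Lemma mode_sum (I : Type) (r : seq I) (P : pred I) d (N : I -> 'M[R]_(k d)) X :
  mode (\sum_(i <- r | P i) N i) X = \sum_(i <- r | P i) mode (N i) X.
Proof.
apply: (big_morph (fun N => mode N X)) => [A B|]; first exact: modeD.
by apply: (@addIr _ (mode (0 : 'M[R]_(k d)) X)); rewrite -modeD !add0r.
Qed.

Lemma tdot_dfmode (k' : 'I_D -> nat) (U : forall d, 'M[R]_(k' d, k d)) d
    (F F' : 'M[R]_(k' d, k d)) X Y :
  (forall d, (U d)^T *m U d = 1%:M) ->
  tdot (mlact (dfmode U F) X) (mlact (dfmode U F') Y) =
  tdot X (mode (F^T *m F') Y).
Proof.
move=> U1; rewrite tdot_mlact mlactM; congr tdot; apply: eq_mlact => e.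
have [->|ned] := eqVneq e d; first by rewrite !dfmode_eq.
by rewrite !(dfmode_neq _ _ ned) U1.
Qed.

Lemma tdot_isometry (k' : 'I_D -> nat) (U : forall d, 'M[R]_(k' d, k d)) X Y :
  (forall d, (U d)^T *m U d = 1%:M) -> tdot (mlact U X) (mlact U Y) = tdot X Y.
Proof.
by move=> U1; rewrite tdot_mlact mlactM (eq_mlact U1) mlact1.
Qed.

End InnerProduct.

(** * Splitting off the components outside the range of the isometry *)

Section OrthogonalSplitting.
Variables (R : realType) (D : nat) (m n : 'I_D -> nat).
Variable Q : forall d, 'M[R]_(n d, m d).
Hypothesis Q1 : forall d, (Q d)^T *m Q d = 1%:M.

Definition cproj d : 'M[R]_(n d) := 1%:M - Q d *m (Q d)^T.

Lemma cprojQ d : cproj d *m Q d = 0.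
Proof. by rewrite mulmxBl mul1mx -mulmxA Q1 mulmx1 subrr. Qed.

Lemma tr_cproj d : (cproj d)^T = cproj d.
Proof. by rewrite raddfB/= trmx1 trmx_mul trmxK. Qed.

Lemma cproj_idem d : cproj d *m cproj d = cproj d.
Proof. by rewrite {2}/cproj mulmxBr mulmx1 mulmxA cprojQ mul0mx subr0. Qed.

Lemma mode_cproj_mlact d (X : tensor R m) : mode (cproj d) (mlact Q X) = 0.
Proof.
have [K eK] := unfolding_mlact Q d X.
apply: (@unfolding_inj _ _ _ d); rewrite unfolding_mode eK !mulmxA cprojQ !mul0mx.
by apply/matrixP => i j; rewrite !mxE /tentry mxE.
Qed.

(** When [x] is expanded over all modes by [1 = Q Q^T + K], every term with two or more factors [K]
    vanishes. *)
Definition one_mode_complement (x : tensor R n) :=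
  forall d e, d != e -> mode (cproj d) (mode (cproj e) x) = 0.

(** The product over the modes of [1 - cproj d], applied to [x], loses its terms of order two and
    higher, leaving [x] minus the sum of the first-order terms. *)
Lemma mlact_projection_decomposition x : one_mode_complement x ->
  x = mlact Q (mlact (fun d => (Q d)^T) x) + \sum_d mode (cproj d) x.
Proof.
move=> x1; rewrite mlactM.
(* The projectors are applied one mode at a time, by induction on the list of modes already
   treated. *)
suff aux (s : seq 'I_D) : uniq s ->
    mlact (fun e => if e \in s then Q e *m (Q e)^T else 1%:M) x =
    x - \sum_(d <- s) mode (cproj d) x.
  have := aux (enum 'I_D) (enum_uniq _).
  rewrite big_enum/= (eq_mlact (B := fun d => Q d *m (Q d)^T)); last first.
    by move=> d; rewrite mem_enum.
  by move=> ->; rewrite subrK.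
elim: s => [_|d s IH /= /andP[nds us]].
  by rewrite big_nil subr0 -[RHS]mlact1; exact: eq_mlact.
rewrite big_cons opprD addrCA -IH//.
transitivity (mode (1%:M - cproj d)
    (mlact (fun e => if e \in s then Q e *m (Q e)^T else 1%:M) x)).
  rewrite /mode mlactM; apply: eq_mlact => e; rewrite inE.
  have [->|ned] := eqVneq e d.
    by rewrite dfmode_eq (negPf nds) mulmx1 /cproj opprB addrC subrK.
  by rewrite (dfmode_neq _ _ ned) mul1mx.
rewrite IH// linearB/= linear_sum/= modeB mode1 addrAC [in RHS]addrC.
congr (_ + _); rewrite !big_seq; congr (_ - _); apply: eq_bigr => e es.
rewrite modeB mode1 x1 ?subr0//.
by apply: contraNneq nds => ->.
Qed.

(** Pair the decomposition with [x]: transposing [Q] and using that [cproj] is a symmetric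
    idempotent turns each term into a squared norm. *)
Lemma tdot_projection_decomposition x : one_mode_complement x ->
  tdot x x =
  tdot (mlact (fun d => (Q d)^T) x) (mlact (fun d => (Q d)^T) x) +
  \sum_d tdot (mode (cproj d) x) (mode (cproj d) x).
Proof.
move=> x1; rewrite {2}[x]mlact_projection_decomposition// tdotDr tdotC tdot_mlact.
congr (_ + _).
rewrite tdot_sumr; apply: eq_bigr => d _.
rewrite tdot_dfmode; last by move=> e; rewrite trmx1 mulmx1.
by rewrite tr_cproj cproj_idem.
Qed.

End OrthogonalSplitting.

(** * Lower bounds for the addition map *)

Section SumBound.
Variables (R : realType) (D nR : nat).

(** For subspaces [S r], not all zero, this says without choosing bases that [c] is at most the
    squared least singular value of the addition map on their product. *)
Definition sum_bound (k : 'I_D -> nat) (S : 'I_nR -> set (tensor R k)) (c : R) :=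
  forall x : 'I_nR -> tensor R k, (forall r, S r (x r)) ->
    c * \sum_r tdot (x r) (x r) <= tdot (\sum_r x r) (\sum_r x r).

Lemma tdot_sum_square (k : 'I_D -> nat) (x : 'I_nR -> tensor R k) :
  tdot (\sum_r x r) (\sum_r x r) = \sum_r \sum_s tdot (x r) (x s).
Proof. by rewrite tdot_suml; apply: eq_bigr => r _; rewrite tdot_sumr. Qed.

Variables (m n : 'I_D -> nat) (Q : forall d, 'M[R]_(n d, m d)).
Hypothesis Q1 : forall d, (Q d)^T *m Q d = 1%:M.

(* Row [j] of [E r *m Q d] is transplanted into one fixed row of mode [d]:
   this keeps all inner products and lands in the tangent spaces at [G r]. *)
Lemma sum_bound_mode (S : 'I_nR -> set (tensor R m)) c (G : 'I_nR -> tensor R m)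
    d (E : 'I_nR -> 'M[R]_(n d)) :
  sum_bound S c -> (forall r (B : 'M[R]_(m d)), S r (mode B (G r))) ->
  c * \sum_r tdot (mode (E r) (mlact Q (G r))) (mode (E r) (mlact Q (G r))) <=
  tdot (\sum_r mode (E r) (mlact Q (G r))) (\sum_r mode (E r) (mlact Q (G r))).
Proof.
move=> Sc SG.
pose F r := E r *m Q d.
have eF r : mode (E r) (mlact Q (G r)) = mlact (dfmode Q (F r)) (G r).
  rewrite /mode mlactM; apply: eq_mlact => e.
  have [->|ned] := eqVneq e d; first by rewrite !dfmode_eq.
  by rewrite !(dfmode_neq _ _ ned) mul1mx.
have tF r s : tdot (mode (E r) (mlact Q (G r))) (mode (E s) (mlact Q (G s))) =
    tdot (G r) (mode ((F r)^T *m F s) (G s)).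
  by rewrite !eF tdot_dfmode.
(* If [m d = 0] there is no row to transplant into, but then [Idx m] is empty and every inner
   product is zero. *)
case: (pickP (fun _ : 'I_(m d) => true)) => [a _|m0]; last first.
  have G0 r X : tdot (G r) X = 0.
    by rewrite /tdot big1// => i _; have := m0 (i d).
  rewrite tdot_sum_square !big1 ?mulr0// => r _; last by rewrite tF G0.
  by rewrite big1// => s _; rewrite tF G0.
pose B r j : 'M[R]_(m d) := delta_mx a 0 *m row j (F r).
have tB r s : \sum_j tdot (mode (B r j) (G r)) (mode (B s j) (G s)) =
    tdot (mode (E r) (mlact Q (G r))) (mode (E s) (mlact Q (G s))).
  rewrite tF.
  have -> : (F r)^T *m F s = \sum_j (B r j)^T *m B s j.
    apply/matrixP => i i'; rewrite mxE summxE; apply: eq_bigr => j _.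
    rewrite [RHS]mxE (bigD1 a)//= [X in _ + X]big1 ?addr0.
      by rewrite !mxE !big_ord1 !mxE !eqxx !mul1r.
    by move=> t nta; rewrite !mxE !big_ord1 !mxE (negPf nta) !mul0r.
  rewrite mode_sum tdot_sumr; apply: eq_bigr => j _.
  by rewrite tdot_dfmode// => e; rewrite trmx1 mulmx1.
(* With the sum over [j] moved outermost on both sides, the claim is the sum over [j] of the
   hypothesis at the vectors [mode (B r j) (G r)]. *)
rewrite tdot_sum_square.
under eq_bigr do rewrite -tB.
under [leRHS]eq_bigr do under eq_bigr do rewrite -tB.
rewrite exchange_big/= mulr_sumr.
under [leRHS]eq_bigr do rewrite exchange_big/=.
rewrite [leRHS]exchange_big/=; apply: ler_sum => j _.
rewrite -tdot_sum_square; apply: Sc => r; exact: SG.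
Qed.

End SumBound.

(** * Transfer of the bounds between the compressed and the full decomposition *)

Section TuckerCompression.
Variables (R : realType) (D nR : nat) (l : 'I_nR -> 'I_D -> nat).
Variable M : forall r : 'I_nR, set (tensor R (l r)).
Arguments M : clear implicits.
Hypothesis coreM : forall r, tucker_core_structure (M r).
Variables (m n : 'I_D -> nat) (Q : forall d, 'M[R]_(n d, m d)).
Hypothesis Q1 : forall d, (Q d)^T *m Q d = 1%:M.
Variable G : 'I_nR -> tensor R m.
Hypothesis MG : forall r, structured_tucker (M r) m (G r).
Hypothesis MA : forall r, structured_tucker (M r) n (mlact Q (G r)).

Let TA r := tangent_space (structured_tucker (M r) n) (mlact Q (G r)).
Let TG r := tangent_space (structured_tucker (M r) m) (G r).

Lemma mlact_trQK (X : tensor R m) : mlact (fun d => (Q d)^T) (mlact Q X) = X.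
Proof. by rewrite mlactM (eq_mlact Q1) mlact1. Qed.

(** The mode-[e] component is [E] acting on the base point; [E] commutes with the projector in mode
    [d], which annihilates the base point. *)
Lemma tangent_space_one_mode_complement r v : TA r v -> one_mode_complement Q v.
Proof.
move=> Tv d e nde.
have [E ->] := tangent_space_mode_factor (coreM r) (MA r) Tv
  (mode_cproj_mlact Q1 e (G r)).
by rewrite mode_comm// mode_cproj_mlact// linear0.
Qed.

(** The isometry embeds the tangent spaces at the [G r] into those at their images, so the bound
    restricts. *)
Lemma sum_bound_compress c : sum_bound TA c -> sum_bound TG c.
Proof.
move=> Ac x Tx.
have := Ac (fun r => mlact Q (x r)).
rewrite -linear_sum/= tdot_isometry//.
under eq_bigr do rewrite tdot_isometry//; apply=> r.
by apply: (tangent_space_mlact (coreM r)) => //; exact: Tx.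
Qed.

Lemma sum_bound_expand c : sum_bound TG c -> sum_bound TA c.
Proof.
move=> Gc v Tv.
have v1 r : one_mode_complement Q (v r).
  exact: tangent_space_one_mode_complement (Tv r).
(* The vanishing condition is linear, so the sum and the summands split into the same components and
   the bound can be proved component by component. *)
have sv1 : one_mode_complement Q (\sum_r v r).
  move=> d e nde; rewrite !linear_sum/= big1// => r _.
  exact: v1.
rewrite (tdot_projection_decomposition Q1 sv1).
under eq_bigr do rewrite (tdot_projection_decomposition Q1 (v1 _)).
rewrite big_split mulrDr; apply: lerD.
  rewrite !linear_sum/=; apply: Gc => r.
  have := tangent_space_mlact (A := fun d => (Q d)^T) (coreM r) _ (Tv r).
  by rewrite mlact_trQK; apply.
(* The component inside the range of [Q] is settled by compressing to the tangent spaces at the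
   [G r]; each [cproj] component has the form that [sum_bound_mode] treats. *)
rewrite exchange_big mulr_sumr; apply: ler_sum => d _.
have /choice[E eE] r : exists E : 'M[R]_(n d),
    mode (cproj Q d) (v r) = mode E (mlact Q (G r)).
  exact: (tangent_space_mode_factor (coreM r) (MA r) (Tv r)
           (mode_cproj_mlact Q1 d (G r))).
have -> : mode (cproj Q d) (\sum_r v r) = \sum_r mode (E r) (mlact Q (G r)).
  by rewrite linear_sum; apply: eq_bigr => r _; exact: eE.
under eq_bigr do rewrite eE; rewrite /=.
have TGB r (B : 'M[R]_(m d)) : TG r (mode B (G r)) by exact: tangent_space_mode.
exact: (sum_bound_mode Q1 E Gc TGB).
Qed.

End TuckerCompression.

(** * Least eigenvalues of symmetric matrices and the least singular value *)

Section LeastEigenvalue.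
Variable R : realType.

(** Row vectors are used because [eigenvalue] refers to eigenvectors acting from the left,
    [v *m S]. *)
Definition dotr N (x y : 'rV[R]_N) : R := (x *m y^T) 0 0.

Lemma dotrC N (x y : 'rV[R]_N) : dotr x y = dotr y x.
Proof. by rewrite /dotr !mxE; apply: eq_bigr => i _; rewrite !mxE mulrC. Qed.

Lemma dotrDl N (x y z : 'rV[R]_N) : dotr (x + y) z = dotr x z + dotr y z.
Proof. by rewrite /dotr mulmxDl mxE. Qed.

Lemma dotrZl N a (x y : 'rV[R]_N) : dotr (a *: x) y = a * dotr x y.
Proof. by rewrite /dotr -scalemxAl mxE. Qed.

Lemma dotrE N (x : 'rV[R]_N) : dotr x x = \sum_i x 0 i ^+ 2.
Proof. by rewrite /dotr mxE; apply: eq_bigr => i _; rewrite mxE. Qed.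

Lemma dotr_ge0 N (x : 'rV[R]_N) : 0 <= dotr x x.
Proof. by rewrite dotrE; apply: sumr_ge0 => i _; exact: sqr_ge0. Qed.

Lemma dotr_eq0 N (x : 'rV[R]_N) : (dotr x x == 0) = (x == 0).
Proof.
apply/idP/eqP => [|->]; last by rewrite /dotr mul0mx mxE.
rewrite dotrE psumr_eq0 => [/allP x0|i _]; last exact: sqr_ge0.
apply/rowP => i; rewrite mxE; apply/eqP; rewrite -sqrf_eq0.
by apply: x0; rewrite mem_index_enum.
Qed.

Lemma continuous_quadratic_form N (S : 'M[R]_N) :
  continuous (fun x : 'rV[R]_N => dotr (x *m S) x).
Proof.
move=> x.
have tx : y^T @[y --> x] --> x^T.
  apply: (cvg_mx (FF := nbhs_filter x)) => i j; rewrite mxE.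
  under eq_fun do rewrite mxE.
  exact: coord_continuous.
have Sx : y *m S @[y --> x] --> x *m S.
  by apply: (cvg_mulmx (FF := nbhs_filter x)); [exact: cvg_id|exact: cvg_cst].
have cx := cvg_mulmx (FF := nbhs_filter x) Sx tx.
exact: (cvg_coord (i := 0) (j := 0) cx).
Qed.

Lemma compact_sphere N : compact [set x : 'rV[R]_N | dotr x x = 1].
Proof.
apply: bounded_closed_compact.
  exists 1; split=> // r r1 x /= x1.
  apply: le_trans (ltW r1); rewrite /Num.Def.normr/= mx_normrE.
  apply: bigmax_le => // -[i j] _ /=; rewrite ord1.
  rewrite -(expr_le1 (n := 2))// real_normK ?num_real// -x1 dotrE.
  by rewrite (bigD1 j)//= lerDl; apply: sumr_ge0 => k _; exact: sqr_ge0.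
apply: (@preimage_closed _ _ (fun x : 'rV[R]_N => dotr x x) [set 1]);
  last exact: closed_eq.
move=> x _; have := @continuous_quadratic_form N 1%:M x.
by rewrite /continuous_at mulmx1; under eq_fun do rewrite mulmx1.
Qed.

(** The Rayleigh quotient attains its minimum [c] on the compact unit sphere, and perturbing the
    minimiser [v] along the residual [w = v S - c v] shows that [w = 0]. *)
Lemma quadratic_form_minimum N (S : 'M[R]_N) : (0 < N)%N -> S^T = S ->
  exists2 c, eigenvalue S c &
    forall x : 'rV[R]_N, c * dotr x x <= dotr (x *m S) x.
Proof.
move=> N0 symS.
have [] := @EVT_min_rV R N (fun x => dotr (x *m S) x) [set x | dotr x x = 1] _
  (@compact_sphere N) (continuous_subspaceT (@continuous_quadratic_form N S)).
  exists (delta_mx 0 (Ordinal N0)).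
  by rewrite /= /dotr trmx_delta mul_delta_mx mxE.
move=> v; rewrite inE/= => v1 minv; pose c := dotr (v *m S) v.
have le_c x : c * dotr x x <= dotr (x *m S) x.
  have [->|x0] := eqVneq x 0; first by rewrite mul0mx /dotr !mul0mx !mxE mulr0.
  have xx0 : 0 < dotr x x by rewrite lt_neqAle dotr_ge0 eq_sym dotr_eq0 x0.
  pose s := Num.sqrt (dotr x x).
  have s2 : s * s = dotr x x by rewrite -expr2 sqr_sqrtr// ltW.
  have s0 : s != 0 by apply: contra_eq_neq s2 => ->; rewrite mulr0 lt_eqF.
  have sx y z : dotr (s^-1 *: y) (s^-1 *: z) = dotr y z / dotr x x.
    by rewrite dotrZl dotrC dotrZl dotrC -s2; field.
  have := minv (s^-1 *: x); rewrite inE/= -scalemxAl !sx mulfV ?gt_eqF//.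
  move=> /(_ erefl).
  by rewrite ler_pdivlMr.
exists c => //; apply/eigenvalueP; exists v; last first.
  by rewrite -dotr_eq0 v1 oner_eq0.
apply/eqP; rewrite -subr_eq0 -dotr_eq0; set w := _ - _.
have symf x y : dotr (x *m S) y = dotr (y *m S) x.
  by rewrite /dotr -mulmxA -{1}symS -trmx_mul -/(dotr _ _) dotrC.
set a := dotr w w; set b := dotr (w *m S) w - c * a.
have ea : dotr (v *m S) w = a + c * dotr v w.
  by rewrite /a {2}/w -scaleNr dotrDl dotrZl mulNr subrK.
(* This is nonnegativity of the form of [S - c] at [v + t w]; the constant term vanishes because [v]
   is a minimiser. *)
have quad t : 0 <= t * a *+ 2 + t ^+ 2 * b.
  have := le_c (v + t *: w); rewrite -subr_ge0.
  rewrite mulmxDl -scalemxAl !dotrDl !dotrZl.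
  rewrite ![dotr _ (v + t *: w)]dotrC !dotrDl !dotrZl.
  rewrite ![dotr _ (v *m S)]dotrC ![dotr _ (w *m S)]dotrC.
  rewrite (symf w v) (dotrC w v) v1 -/c /b -/a.
  by congr (_ <= _); rewrite ea; ring.
have a0 : 0 <= a by exact: dotr_ge0.
have b0 : 0 <= b by rewrite subr_ge0; exact: le_c.
apply: contraT => na; have {}a0 : 0 < a by rewrite lt_neqAle eq_sym na.
(* At [t = - u] the quadratic equals [- u (a + u a) < 0]; dividing by [a + b] rather than [b] also
   covers [b = 0]. *)
pose u := a / (a + b).
have ab0 : 0 < a + b by rewrite ltr_wpDr.
have u0 : 0 < u by rewrite divr_gt0.
have uab : u * (a + b) = a by rewrite /u divfK// gt_eqF.
have := quad (- u).
suff -> : - u * a *+ 2 + (- u) ^+ 2 * b = - (u * (a + u * a)).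
  by rewrite oppr_ge0 leNgt mulr_gt0// addr_gt0// mulr_gt0.
have -> : b = (a + b) - a by rewrite addrAC subrr add0r.
rewrite sqrrN mulrBr expr2 -(mulrA u u (a + b)) uab; ring.
Qed.

(** Positive semidefiniteness of [T^T *m T - c]. *)
Definition gram_bound P N (T : 'M[R]_(P, N)) (c : R) :=
  forall x : 'cV[R]_N, c * (x^T *m x) 0 0 <= ((T *m x)^T *m (T *m x)) 0 0.

Lemma gram_dotr P N (T : 'M[R]_(P, N)) (x : 'cV[R]_N) :
  ((T *m x)^T *m (T *m x)) 0 0 = dotr (x^T *m (T^T *m T)) x^T.
Proof. by rewrite /dotr trmxK trmx_mul !mulmxA. Qed.

(** Each eigenvalue is the Rayleigh quotient of its eigenvector and the least quotient is itself an
    eigenvalue, so the infimum of the spectrum is that least quotient. *)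
Lemma gram_boundP P N (T : 'M[R]_(P, N)) c : (0 < N)%N ->
  gram_bound T c <-> c <= inf [set mu | eigenvalue (T^T *m T) mu].
Proof.
move=> N0.
have [||mu emu min_mu] := @quadratic_form_minimum N (T^T *m T) => //.
  by rewrite trmx_mul trmxK.
have eigen_ge nu : eigenvalue (T^T *m T) nu -> exists2 v : 'rV[R]_N,
    0 < dotr v v & dotr (v *m (T^T *m T)) v = nu * dotr v v.
  move=> /eigenvalueP[v ev v0]; exists v; last by rewrite ev dotrZl.
  by rewrite lt_neqAle dotr_ge0 eq_sym dotr_eq0 v0.
have -> : inf [set mu | eigenvalue (T^T *m T) mu] = mu.
  apply/eqP; rewrite eq_le; apply/andP; split.
    apply: ge_inf => //; exists mu => nu /= /eigen_ge[v v0 ev].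
    by rewrite -(ler_pM2r v0) -ev min_mu.
  apply: lb_le_inf; first by exists mu.
  by move=> nu /= /eigen_ge[v v0 ev]; rewrite -(ler_pM2r v0) -ev min_mu.
split=> [Tc|lec x].
  have [v v0 ev] := eigen_ge mu emu.
  have := Tc v^T; rewrite gram_dotr trmxK ev.
  by rewrite -[(v *m v^T) 0 0]/(dotr v v) ler_pM2r.
rewrite gram_dotr; apply: le_trans (min_mu _).
rewrite /dotr trmxK; apply: ler_wpM2r lec.
by have := dotr_ge0 x^T; rewrite /dotr trmxK.
Qed.

Lemma gram_bound0 P N (T : 'M[R]_(P, N)) c : N = 0 -> gram_bound T c.
Proof.
move=> N0 x; have -> : x = 0 by apply/colP => -[i iN]; exfalso; rewrite N0 in iN.
by rewrite !mulmx0 mxE mulr0.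
Qed.

Lemma spectrum0 N (S : 'M[R]_N) : N = 0 -> [set mu | eigenvalue S mu] = set0.
Proof.
move=> N0; rewrite -subset0 => mu /= /eigenvalueP[v _ /negP[]].
by apply/eqP/rowP => -[i iN]; exfalso; rewrite N0 in iN.
Qed.

Lemma gram_bound_eq_sigma_last P N P' N'
    (T : 'M[R]_(P, N)) (T' : 'M[R]_(P', N')) :
  (forall c, gram_bound T c <-> gram_bound T' c) -> sigma_last T = sigma_last T'.
Proof.
wlog NN' : P N P' N' T T' / (N <= N')%N.
  move=> H TT'; have [NN'|/ltnW NN'] := leqP N N'; first exact: H.
  by apply/esym/H => // c; split=> /TT'.
(* If neither matrix has columns, both spectra are empty and the two infima take the same default
   value. *)
have [N'0 _|N'0] := posnP N'.
  have N0 : N = 0 by apply/eqP; rewrite -leqn0 -[X in (_ <= X)%N]N'0.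
  by rewrite /sigma_last !spectrum0.
have [N0 TT'|N0 TT'] := posnP N.
  (* Without columns [T] admits every [c], whereas [T'] rejects any [c] above its least
     eigenvalue. *)
  exfalso.
  have : inf [set mu | eigenvalue (T'^T *m T') mu] + 1 <=
         inf [set mu | eigenvalue (T'^T *m T') mu].
    by apply/(gram_boundP _ _ N'0)/TT'; exact: gram_bound0.
  by rewrite leNgt ltrDl ltr01.
rewrite /sigma_last; congr Num.sqrt; apply/eqP; rewrite eq_le.
by apply/andP; split; apply/gram_boundP => //; apply/TT'; apply/gram_boundP.
Qed.
End LeastEigenvalue.

(** * The Terracini matrix and the addition map *)

Section Terracini.
Variables (R : realType) (D nR : nat) (k : 'I_D -> nat).
Variables (S : 'I_nR -> set (tensor R k)) (N : 'I_nR -> nat).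
Variable T : forall r, 'M[R]_(#|Idx k|, N r).
Arguments S : clear implicits.
Hypothesis onbT : forall r, onb_of (S r) (T r).

(** Block coordinates [y r] correspond to the vectors [T r *m y r] of [S r], with equal norms since
    the columns of [T r] are orthonormal. *)
Lemma gram_bound_mxrow c : gram_bound (\mxrow_r T r) c <-> sum_bound S c.
Proof.
have eT (y : forall r, 'cV[R]_(N r)) :
    (\mxrow_r T r) *m (\mxcol_r y r) = \sum_r T r *m y r.
  exact: mul_mxrow_mxcol.
have ey (y : forall r, 'cV[R]_(N r)) :
    ((\mxcol_r y r)^T *m (\mxcol_r y r)) 0 0 =
    \sum_r tdot (T r *m y r) (T r *m y r).
  rewrite tr_mxcol mul_mxrow_mxcol summxE; apply: eq_bigr => r _.
  by rewrite tdotE trmx_mul mulmxA -(mulmxA _ _ (T r)) (onbT r).1 mulmx1.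
split=> [Tc x Sx|Sc y].
  have ex r : exists y : 'cV[R]_(N r), x r = T r *m y by apply/(onbT r).2.
  pose y r := projT1 (cid (ex r)).
  have xy r : x r = T r *m y r by rewrite /y; case: cid.
  have := Tc (\mxcol_r y r); rewrite eT ey -tdotE.
  by under eq_bigr do rewrite -xy; under [in leRHS]eq_bigr do rewrite -xy.
rewrite -[y]submxcolK eT ey -tdotE.
by apply: Sc => r; apply/(onbT r).2; eexists.
Qed.

End Terracini.

Theorem theorem5p1 (R : realType) (D nR : nat)
  (l : 'I_nR -> 'I_D -> nat)
  (M : forall r : 'I_nR, set (tensor R (l r)))
  (n m : 'I_D -> nat)
  (A : tensor R n) (Q : forall d, 'M[R]_(n d, m d)) (G : tensor R m)
  (As : 'I_nR -> tensor R n) (Gs : 'I_nR -> tensor R m) :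
  (forall r, tucker_core_structure (M r)) ->
  (forall d, (Q d)^T *m Q d = 1%:M) ->
  A = mlact Q G ->
  A = \sum_(r < nR) As r ->
  (forall r, structured_tucker (M r) n (As r)) ->
  G = \sum_(r < nR) Gs r ->
  (forall r, structured_tucker (M r) m (Gs r)) ->
  (forall r, As r = mlact Q (Gs r)) ->
  forall (NA NG : 'I_nR -> nat)
         (TA : forall r, 'M[R]_(#|Idx n|, NA r))
         (TG : forall r, 'M[R]_(#|Idx m|, NG r)),
  (forall r, onb_of (tangent_space (structured_tucker (M r) n) (As r)) (TA r)) ->
  (forall r, onb_of (tangent_space (structured_tucker (M r) m) (Gs r)) (TG r)) ->
  kappa_terracini TA = kappa_terracini TG.
Proof.
move=> coreM Q1 _ _ MA _ MG eA NA NG TA TG onbA onbG.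
have {}MA r : structured_tucker (M r) n (mlact Q (Gs r)) by rewrite -eA.
have {}onbA r :
    onb_of (tangent_space (structured_tucker (M r) n) (mlact Q (Gs r))) (TA r).
  by rewrite -eA.
rewrite /kappa_terracini /inv_sigma.
suff -> : sigma_last (\mxrow_r TA r) = sigma_last (\mxrow_r TG r) by [].
(* The two Terracini matrices may differ in both dimensions, so they are compared through the
   constants [c] that bound them from below. *)
apply: gram_bound_eq_sigma_last => c.
rewrite (gram_bound_mxrow onbA) (gram_bound_mxrow onbG).
by split; [exact: sum_bound_compress|exact: sum_bound_expand].
Qed.
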